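(* Let $\mathcal{H}$ be a separable Hilbert space, $K\in B(\mathcal{H})$, let $F=\{f_i\}_{i\in I}$ be a $K$-frame for $\mathcal{H}$ and let $\{g_i\}_{i\in I}$ be a $K$-dual of $F$. Then for every bounded sequence of scalars $\{\alpha_i\}_{i\in I}$ and every $f\in\mathcal{H}$, $$\left(\sum_{i\in I}\alpha_i\langle f,g_i\rangle\,\overline{\langle Kf,f_i\rangle}\right)-\left\Vert\sum_{i\in I}\alpha_i\langle f,g_i\rangle f_i\right\Vert^2=\left(\sum_{i\in I}(1-\overline{\alpha_i})\,\overline{\langle f,g_i\rangle}\,\langle Kf,f_i\rangle\right)-\left\Vert\sum_{i\in I}(1-\alpha_i)\langle f,g_i\rangle f_i\right\Vert^2 .$$
   Context: $B(\mathcal{H})$ is the set of bounded linear operators on $\mathcal{H}$, $I$ is a countable index set, and the inner product is linear in the first variable. A sequence $\{f_i\}_{i\in I}\subseteq\mathcal{H}$ is a $K$-frame for $\mathcal{H}$ if there exist constants $A,B>0$ such that $A\Vert K^*f\Vert^2\le\sum_{i\in I}|\langle f,f_i\rangle|^2\le B\Vert f\Vert^2$ for all $f\in\mathcal{H}$. A sequence $\{g_i\}_{i\in I}\subseteq\mathcal{H}$ is Bessel if there is $B'>0$ with $\sum_{i\in I}|\langle f,g_i\rangle|^2\le B'\Vert f\Vert^2$ for all $f\in\mathcal{H}$. A Bessel sequence $\{g_i\}_{i\in I}$ is a $K$-dual of $\{f_i\}_{i\in I}$ if $Kf=\sum_{i\in I}\langle f,g_i\rangle f_i$ for all $f\in\mathcal{H}$.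 *)

(* Defs.v *)
From HB Require Import structures.
From mathcomp Require Export all_boot all_order all_algebra sesquilinear.
From mathcomp Require Export complex.
From mathcomp Require Export all_classical all_reals ereal topology normedtype.
From mathcomp Require Export esum.
From mathcomp.analysis.showcase Require Export summability.

Set Implicit Arguments.
Unset Strict Implicit.
Unset Printing Implicit Defensive.

Export Order.TTheory GRing.Theory Num.Theory Num.Def.
Export numFieldNormedType.Exports.

Global Open Scope classical_set_scope.
Global Open Scope ring_scope.

Section hilbert.
Variable R : realType.
Local Notation C := R[i].

(* Norms of a normedModType over R[i] are R[i]-valued (with zero imaginary
   part); this is the square of the norm as an element of R. *)
Definition sqnorm (W : normedModType C) (x : W) : R := complex.Re (`|x| ^+ 2).

Definition separable (V : normedModType C) : Prop :=
  exists2 D : set V, countable D & dense D.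

(* The norm (hence the topology and the completeness) of V is the one induced
   by the inner product; {dot V for conjC} is linear in its first variable. *)
Definition norm_from_dot (V : normedModType C) (dot : {dot V for conjC}) :=
  forall x : V, `|x| ^+ 2 = dot x x.

Definition is_adjoint (V : normedModType C) (dot : {dot V for conjC})
    (K Ks : V -> V) : Prop :=
  forall x y : V, dot (K x) y = dot x (Ks y).

(* The value 0 is a default that is not taken for bounded operators on Hilbert
   spaces, by the Riesz representation theorem. *)
Definition adjoint (V : normedModType C) (dot : {dot V for conjC})
    (K : V -> V) (y : V) : V :=
  xget 0 [set z | forall x : V, dot (K x) y = dot x z].

Lemma adjoint_unique (V : normedModType C) (dot : {dot V for conjC})
    (K Ks : V -> V) : is_adjoint dot K Ks -> adjoint dot K = Ks.
Proof.
move=> KKs; apply/funext => y; rewrite /adjoint.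
case: xgetP => [z _ /= Kz|/(_ (Ks y))]; last by case=> x; exact: KKs.
apply/eqP; rewrite -subr_eq0; apply/negPn/negP => /(@neq0_dnorm_gt0 _ _ _ dot).
set w := z - Ks y; have /eqP := etrans (esym (Kz w)) (KKs w y).
by rewrite -subr_eq0 -(linearBr dot w z (Ks y)) => /eqP ->; rewrite ltxx.
Qed.

(* Sums over the countable set I are unordered: `partial_sum x` is a net
   indexed by the finite subsets of I, directed by inclusion (filter
   `totally`), and `sum x` is its limit. *)
Definition sum_converges (I : choiceType) (W : normedModType C) (x : I -> W)
    : Prop :=
  cvg (partial_sum x @ totally).

Definition has_sum (I : choiceType) (W : normedModType C) (x : I -> W) (s : W)
    : Prop :=
  partial_sum x @ totally --> s.

Section frames.
Variables (V : normedModType C) (dot : {dot V for conjC}) (I : countType).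

(* \sum_i |<x, f_i>|^2 in [0, +oo]; C^o is C as a normed module over itself *)
Definition coef_energy (f : I -> V) (x : V) : \bar R :=
  (\esum_(i in [set: I]) (sqnorm (dot x (f i) : C^o))%:E)%E.

Definition K_frame (K : V -> V) (f : I -> V) : Prop :=
  exists A B : R, [/\ 0 < A, 0 < B &
    forall x : V,
      ((A * sqnorm (adjoint dot K x))%:E <= coef_energy f x
        <= (B * sqnorm x)%:E)%E].

Definition Bessel (g : I -> V) : Prop :=
  exists2 B : R, 0 < B &
    forall x : V, (coef_energy g x <= (B * sqnorm x)%:E)%E.

Definition K_dual (K : V -> V) (f g : I -> V) : Prop :=
  Bessel g /\ forall x : V, has_sum (fun i => dot x (g i) *: f i) (K x).

End frames.

End hilbert.

(* Main.v *)
Require Import Defs.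
From mathcomp Require Import finmap ring.

Set Implicit Arguments.
Unset Strict Implicit.
Unset Printing Implicit Defensive.

(** Put u1 = sum_i alpha_i <x, g_i> f_i and u2 = sum_i (1 - alpha_i) <x, g_i> f_i.
    The duality of f and g says that u1 + u2 = K x.  By linearity and continuity
    of the inner product, the scalar sum on the left of the identity is
    <u1, K x> and the one on the right is <K x, u2>, so that both sides are
    equal to <u1, u2>:
<<
      <u1, u1 + u2> - <u1, u1> = <u1, u2> = <u1 + u2, u2> - <u2, u2>.
>>
    The analytic content is the unconditional convergence of the series u1.
    The coefficients alpha_i <x, g_i> are square summable, because g is Bessel
    and alpha is bounded, and a K-frame f is Bessel.  For a Bessel family f with
    bound B, the norm of a finite combination of the f_i is controlled by the
    l2-norm of its coefficients ([synthesis_bound]); hence the net of finite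
    partial sums is Cauchy, and it converges by completeness
    ([Bessel_synthesis]).  The series u2 then converges as the difference of the
    series of K x and of u1, and the scalar series converge as images of u1 and
    u2 under bounded additive maps ([has_sum_bounded_additive]). *)

Lemma normrB_sqr (R : realType) (z w : R[i]) :
  `|z - w| ^+ 2 = `|z| ^+ 2 + `|w| ^+ 2 - (z * w^* + (z * w^*)^*).
Proof. by rewrite !normCK !rmorphB !rmorphM /= conjCK; ring. Qed.

Lemma sqnormE (R : realType) (W : normedModType R[i]) (w : W) :
  (sqnorm w)%:C%C = `|w| ^+ 2.
Proof. by rewrite /sqnorm RRe_real// realX// normr_real. Qed.

(** Squares of norms are compared in R rather than in R[i], since the suprema
    used for the convergence of the series are taken in R. *)
Lemma bounded_fun_sqnorm (R : realType) (I : Type) (W : normedModType R[i])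
    (b : I -> W) : bounded_fun b ->
  exists2 M : R, 0 <= M & forall i, sqnorm (b i) <= M.
Proof.
case=> M0 [M0r bM]; have M1 : 0 <= `|M0| + 1 by rewrite addr_ge0.
exists (complex.Re ((`|M0| + 1) ^+ 2)).
  by rewrite -lecR RRe_real ?exprn_ge0// ger0_real ?exprn_ge0.
move=> i; rewrite -lecR sqnormE RRe_real ?ger0_real ?exprn_ge0//.
rewrite ler_sqr ?nnegrE//; apply: bM => //=.
by rewrite ltr_pwDr// real_ler_norm.
Qed.

Lemma partial_sumE (I : choiceType) (W : zmodType) (x : I -> W)
    (J : {fset I}) : partial_sum x J = \sum_(i <- J) x i.
Proof. by rewrite /partial_sum [RHS]big_seq_fsetE. Qed.

Lemma partial_sum_fsetD (I : choiceType) (W : zmodType) (x : I -> W)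
    (J L : {fset I}) : (J `<=` L)%fset ->
  partial_sum x L = partial_sum x J + partial_sum x (L `\` J)%fset.
Proof.
move=> JL; rewrite !partial_sumE (big_fsetID _ (mem J)) /=.
congr (_ + _); apply: eq_fbigl => i; rewrite !inE /= ?[_ && (i \notin J)]andbC//.
by have [/(fsubsetP JL) ->|] := boolP (i \in J); rewrite ?andbF.
Qed.

Lemma esum_fset_le (R : realType) (I : choiceType) (a : I -> R) (b : R)
    (J : {fset I}) :
  (\esum_(i in [set: I]) (a i)%:E <= b%:E)%E -> \sum_(i <- J) a i <= b.
Proof.
move=> ab; rewrite -lee_fin; apply: le_trans ab; apply: esum_ge.
exists [set` J]; first by split.
by rewrite fsbig_finite//= set_fsetK sumEFin.
Qed.

Section has_sum.
Variables (R : realType) (I : choiceType) (W : normedModType R[i]).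
Implicit Types (x y : I -> W) (s t : W).
#[local] Existing Instance totally_filter.

Lemma has_sum_converges x s : has_sum x s -> sum_converges x.
Proof. by move=> xs; apply/cvg_ex; exists s. Qed.

Lemma has_sum_sum x s : has_sum x s -> sum x = s.
Proof. by move=> xs; apply: cvg_lim; first exact: norm_hausdorff. Qed.

Lemma has_sumB x y s t :
  has_sum x s -> has_sum y t -> has_sum (fun i => x i - y i) (s - t).
Proof.
move=> xs yt; rewrite /has_sum.
have -> : partial_sum (fun i => x i - y i) =
          (fun J => partial_sum x J - partial_sum y J).
  by apply/funext => J; rewrite !partial_sumE sumrB.
exact: cvgB.
Qed.

(** Additivity is asked instead of linearity so that the lemma applies to the
    inner product in either variable, also the conjugate linear one. *)
Lemma has_sum_bounded_additive (W' : normedModType R[i])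
    (h : {additive W -> W'}) (M : R[i]) x s : 0 <= M ->
  (forall w, `|h w| <= M * `|w|) -> has_sum x s ->
  has_sum (fun i => h (x i)) (h s).
Proof.
move=> M0 hM /cvgrPdist_lt xs; apply/cvgrPdist_lt => e e0.
(* M may be 0, hence the division by M + 1. *)
have M1 : 0 < M + 1 by rewrite ltr_wpDl.
near=> J; rewrite partial_sumE -raddf_sum -raddfB.
apply: le_lt_trans (hM _) _.
have : `|s - partial_sum x J| < e / (M + 1).
  by near: J; apply: xs; rewrite divr_gt0.
rewrite partial_sumE ltr_pdivlMr// mulrC; apply: le_lt_trans.
by rewrite ler_wpM2r// lerDl.
Unshelve. all: by end_near.
Qed.

End has_sum.

Section hilbert.
Variables (R : realType) (V : completeNormedModType R[i])
  (dot : {dot V for conjC}).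
#[local] Existing Instance totally_filter.
Hypothesis Vdot : norm_from_dot dot.
Local Notation C := R[i].

Lemma dotC u v : (dot u v)^* = dot v u.
Proof. by rewrite (hermC dot v u) mul1r. Qed.

(** Let w be the finite combination.  Since sum_i a_i conj <w, f_i> = |w|^2,
    expanding the nonnegative sum of the |B a_i - <w, f_i>|^2 gives
    2 B |w|^2 <= B^2 sum_i |a_i|^2 + sum_i |<w, f_i>|^2, where the last sum is at
    most B |w|^2. *)
Lemma synthesis_bound (I : choiceType) (f : I -> V) (B : C) (a : I -> C)
    (J : {fset I}) : 0 < B ->
  (forall u, \sum_(i <- J) `|dot u (f i)| ^+ 2 <= B * `|u| ^+ 2) ->
  `|\sum_(i <- J) a i *: f i| ^+ 2 <= B * \sum_(i <- J) `|a i| ^+ 2.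
Proof.
move=> B0 fB; set w := \sum_(i <- J) _.
have wE : \sum_(i <- J) a i * (dot w (f i))^* = `|w| ^+ 2.
  rewrite Vdot [in RHS]/w linear_sumlz; apply: eq_bigr => i _.
  by rewrite linearZl_LR dotC.
have : 0 <= \sum_(i <- J) `|B * a i - dot w (f i)| ^+ 2.
  by apply: sumr_ge0 => i _; rewrite exprn_ge0.
under eq_bigr => i _ do rewrite normrB_sqr normrM exprMn (gtr0_norm B0) -mulrA.
rewrite sumrB !big_split /= -!mulr_sumr -rmorph_sum/= -mulr_sumr wE.
have BwR : (B * `|w| ^+ 2)^* = B * `|w| ^+ 2.
  by rewrite conj_Creal// ger0_real// mulr_ge0 ?exprn_ge0 ?(ltW B0).
rewrite BwR subr_ge0 => h.
have : B * `|w| ^+ 2 <= B * (B * \sum_(i <- J) `|a i| ^+ 2).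
  rewrite -(lerD2r (B * `|w| ^+ 2)) (le_trans h)// mulrA -expr2 lerD2l.
  exact: fB.
by rewrite ler_pM2l.
Qed.

(** Cauchy-Schwarz inequality, from the nonnegativity of the squared norm of
    |v|^2 u - <u, v> v. *)
Lemma dot_le (u v : V) : `|dot u v| <= `|v| * `|u|.
Proof.
rewrite -ler_sqr ?nnegrE ?mulr_ge0// exprMn.
have [->|v0] := eqVneq v 0; first by rewrite linear0r !normr0 expr0n mul0r.
have v1 : 0 < `|v| ^+ 2 by rewrite exprn_gt0// normr_gt0.
suff : 0 <= `|v| ^+ 2 * (`|v| ^+ 2 * `|u| ^+ 2 - `|dot u v| ^+ 2).
  by rewrite pmulr_rge0// subr_ge0.
have := dnorm_ge0 dot (`|v| ^+ 2 *: u - dot u v *: v).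
rewrite linearBl !linearBr !linearZl_LR !linearZr_LR /= -!Vdot -(dotC u v).
rewrite normCK; congr (0 <= _).
rewrite rmorphXn /= (conj_Creal (normr_real v)); ring.
Qed.

Lemma has_sum_dotl (I : choiceType) (x : I -> V) s v : has_sum x s ->
  has_sum (fun i => dot (x i) v : C^o) (dot s v).
Proof.
move=> xs; apply: (@has_sum_bounded_additive _ _ _ _ (applyr dot v) `|v|) xs.
  exact: normr_ge0.
by move=> w; exact: dot_le.
Qed.

Lemma has_sum_dotr (I : choiceType) (x : I -> V) s v : has_sum x s ->
  has_sum (fun i => dot v (x i) : C^o) (dot v s).
Proof.
move=> xs; apply:
  (@has_sum_bounded_additive _ _ _ C^o (dot v : {additive V -> C}) `|v|) xs.
  exact: normr_ge0.
by move=> w; rewrite mulrC; exact: dot_le.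
Qed.

Lemma Bessel_fset (I : countType) (f : I -> V) : Bessel dot f ->
  exists2 B : R, 0 < B & forall (J : {fset I}) u,
    \sum_(i <- J) sqnorm (dot u (f i) : C^o) <= B * sqnorm u.
Proof.
by case=> B B0 fB; exists B => // J u; apply: esum_fset_le; exact: fB.
Qed.

(** A finite set J whose sum of |a_i|^2 is within e^2 / B of the supremum
    leaves less than e^2 / B to any finite set disjoint from it, so that by the
    synthesis bound all later partial sums are within e of the one over J. *)
Lemma Bessel_synthesis (I : countType) (f : I -> V) (a : I -> C^o) (M : R) :
  Bessel dot f ->
  (forall J : {fset I}, \sum_(i <- J) sqnorm (a i) <= M) ->
  exists s, has_sum (fun i => a i *: f i) s.
Proof.
move=> /Bessel_fset[B B0 fB] aM.
suff : cvg (partial_sum (fun i => a i *: f i) @ totally).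
  by case/cvg_ex => s; exists s.
apply: cauchy_cvg; apply: cauchy_exP => e e0.
pose E := range (fun J : {fset I} => \sum_(i <- J) sqnorm (a i)).
have supE : has_sup E.
  split; first by exists (\sum_(i <- fset0) sqnorm (a i)), fset0.
  by exists M => _ [J _ <-]; exact: aM.
have eE : e = (complex.Re e)%:C%C by rewrite RRe_real// gtr0_real.
have r0 : 0 < complex.Re e by rewrite -ltcR -eE.
have d0 : 0 < complex.Re e ^+ 2 / B by rewrite divr_gt0// exprn_gt0.
have [_ [J _ <-] Jd] := sup_adherent d0 supE.
exists (partial_sum (fun i => a i *: f i) J), J => //= L JL.
rewrite -ball_normE /= (partial_sum_fsetD _ JL) opprD addrA subrr sub0r normrN.
rewrite -ltr_sqr ?nnegrE ?(ltW e0)// partial_sumE.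
have Bc : 0 < B%:C%C :> C by rewrite ltcR.
apply: le_lt_trans (synthesis_bound _ Bc _) _.
  move=> u; rewrite -sqnormE -rmorphM/=.
  under eq_bigr => i _ do rewrite -(sqnormE (dot u (f i) : C^o)).
  by rewrite -rmorph_sum lecR; exact: fB.
under eq_bigr => i _ do rewrite -(sqnormE (a i)).
rewrite -rmorph_sum -rmorphM eE -rmorphXn ltcR/= mulrC -ltr_pdivlMr//.
have : \sum_(i <- L) sqnorm (a i) <= sup E
  by apply: ub_le_sup; [exact: supE.2 | exists L].
rewrite -[X in X <= _](partial_sumE (fun i => sqnorm (a i))).
rewrite (partial_sum_fsetD _ JL) !partial_sumE => h.
by rewrite -(ltrD2l (\sum_(i <- J) sqnorm (a i))) (le_lt_trans h)// -ltrBlDr.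
Qed.

Lemma Bessel_multiplier (I : countType) (f g : I -> V) (b : I -> C) x :
  Bessel dot f -> Bessel dot g -> bounded_fun (b : I -> C^o) ->
  exists s, has_sum (fun i => (b i * dot x (g i)) *: f i) s.
Proof.
move=> fB /Bessel_fset[B B0 gB] /bounded_fun_sqnorm[M M0 bM].
apply: (@Bessel_synthesis I f _ (M * (B * sqnorm x))) => // J.
apply: (@le_trans _ _ (\sum_(i <- J) M * sqnorm (dot x (g i) : C^o))).
  apply: ler_sum => i _; rewrite -lecR rmorphM /= !sqnormE normrM exprMn.
  by rewrite ler_wpM2r ?exprn_ge0// -(sqnormE (b i : C^o)) lecR.
by rewrite -mulr_sumr ler_wpM2l.
Qed.

End hilbert.

Lemma K_frame_Bessel (R : realType) (V : normedModType R[i])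
    (dot : {dot V for conjC}) (I : countType) (K : V -> V) (f : I -> V) :
  K_frame dot K f -> Bessel dot f.
Proof. by case=> A [B [_ B0 AB]]; exists B => // u; case/andP: (AB u). Qed.

Theorem theorem2p3 (R : realType) (V : completeNormedModType R[i])
    (dot : {dot V for conjC}) (I : countType)
    (K : {linear V -> V}) (f g : I -> V)
    (Vdot : norm_from_dot dot) (Vsep : separable V)
    (Kbounded : bounded_near K (nbhs (0 : V)))
    (fK : K_frame dot K f) (gK : K_dual dot K f g)
    (alpha : I -> R[i]) (alphabounded : bounded_fun (alpha : I -> R[i]^o))
    (x : V) :
  let S1 (i : I) : R[i]^o := alpha i * dot x (g i) * (dot (K x) (f i))^* in
  let v1 (i : I) : V := (alpha i * dot x (g i)) *: f i in
  let S2 (i : I) : R[i]^o :=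
    (1 - (alpha i)^*) * (dot x (g i))^* * dot (K x) (f i) in
  let v2 (i : I) : V := ((1 - alpha i) * dot x (g i)) *: f i in
  [/\ sum_converges S1, sum_converges v1, sum_converges S2, sum_converges v2 &
    sum S1 - `|sum v1| ^+ 2 = sum S2 - `|sum v2| ^+ 2].
Proof.
move=> S1 v1 S2 v2; have [gB Kx] := gK.
have [u1 v1u] : exists u1, has_sum v1 u1.
  by apply: Bessel_multiplier => //; exact: K_frame_Bessel fK.
set u2 := K x - u1.
have v2u : has_sum v2 u2.
  have -> : v2 = (fun i => dot x (g i) *: f i - v1 i).
    by apply/funext => i; rewrite /v1 /v2 -scalerBl mulrBl mul1r.
  exact: has_sumB.
have S1u : has_sum S1 (dot u1 (K x)).
  have -> : S1 = (fun i => dot (v1 i) (K x)).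
    by apply/funext => i; rewrite /S1 /v1 linearZl_LR dotC.
  exact: has_sum_dotl.
have S2u : has_sum S2 (dot (K x) u2).
  have -> : S2 = (fun i => dot (K x) (v2 i)).
    by apply/funext => i; rewrite /S2 /v2 linearZr_LR /= rmorphM rmorphB rmorph1.
  exact: has_sum_dotr.
split; [exact: has_sum_converges S1u | exact: has_sum_converges v1u |
  exact: has_sum_converges S2u | exact: has_sum_converges v2u |].
rewrite (has_sum_sum S1u) (has_sum_sum v1u) (has_sum_sum S2u) (has_sum_sum v2u).
rewrite !Vdot.
have -> : K x = u1 + u2 by rewrite addrC subrK.
by rewrite linearDr linearDl addrAC subrr add0r addrK.
Qed.
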